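(* For all $n \ge 1$ and all $k \ge 2$ there exists a bijection between $S_n(123, 132, (k-1)(k-2)\ldots 1\,k)$ and the set of tilings of a $1 \times n$ rectangle with tiles of sizes $1\times 1, 1\times 2, \ldots, 1\times (k-1)$.
   Context: Permutations of $[n]$ are written in one-line notation, and $S_n$ denotes the set of them. A permutation $\pi\in S_n$ contains $\sigma\in S_m$ if there are indices $i_1<\dots<i_m$ such that for all $a,b$, $\pi(i_a)<\pi(i_b)$ iff $\sigma(a)<\sigma(b)$; otherwise $\pi$ avoids $\sigma$. For a set $R$ of permutations, $S_n(R)$ is the set of $\pi\in S_n$ avoiding every element of $R$. The permutation $(k-1)(k-2)\ldots 1\,k\in S_k$ lists $k-1,\dots,1$ in decreasing order followed by $k$. *)

(* Defs.v *)
From mathcomp Require Import all_boot all_fingroup zify.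

Set Implicit Arguments.
Unset Strict Implicit.
Unset Printing Implicit Defensive.

(* Permutations of [n] are elements of 'S_n = {perm 'I_n}: positions and values
   are numbered from 0 instead of 1. *)
Definition one_line n (s : 'S_n) : seq nat := [seq (s i).+1 | i <- enum 'I_n].

Definition contains n m (s : 'S_n) (t : 'S_m) : bool :=
  [exists f : {ffun 'I_m -> 'I_n},
    [forall a : 'I_m, forall b : 'I_m, (a < b) ==> (f a < f b)] &&
    [forall a : 'I_m, forall b : 'I_m, (s (f a) < s (f b)) == (t a < t b)]].

Definition pattern : Type := {m : nat & 'S_m}.

Definition Pattern m (t : 'S_m) : pattern := existT _ m t.

Definition avoiders n (R : seq pattern) : {set 'S_n} :=
  [set s : 'S_n | all (fun p : pattern => ~~ contains s (projT2 p)) R].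

Definition p123 : 'S_3 := 1%g.

Definition p132 : 'S_3 := tperm (inord 1) (inord 2).

Fact dec_max_subproof k (i : 'I_k) : (if i.+1 < k then k - 2 - i else i) < k.
Proof. by have := ltn_ord i; case: ifP; lia. Qed.

Definition dec_max_fun k (i : 'I_k) : 'I_k := Ordinal (dec_max_subproof i).

Fact dec_max_fun_inj k : injective (@dec_max_fun k).
Proof.
move=> i j /(congr1 val) /= eq_ij; apply: val_inj => /=.
have := ltn_ord i; have := ltn_ord j; move: eq_ij.
by case: ifP; case: ifP; lia.
Qed.

(* The permutation (k-1)(k-2)...1 k. *)
Definition dec_max k : 'S_k := perm (@dec_max_fun_inj k).

(* A tile of size 1 x l is a block of l consecutive cells among the n cells of
   the rectangle; a tiling is the set of its tiles. *)
Definition is_tile n l (B : {set 'I_n}) : bool :=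
  [exists i : 'I_n, (i + l <= n) && (B == [set x : 'I_n | i <= x < i + l])].

(* Tilings of a 1 x n rectangle by tiles of sizes 1 x 1, ..., 1 x d. *)
Definition tilings n d : {set {set {set 'I_n}}} :=
  [set T : {set {set 'I_n}} | partition T [set: 'I_n] &&
     [forall B in T, exists l : 'I_d, is_tile l.+1 B]].

Fact one_line_p123 : one_line p123 = [:: 1; 2; 3].
Proof. by rewrite /one_line !enum_ordSl enum_ord0 /= !perm1. Qed.

Fact one_line_p132 : one_line p132 = [:: 1; 3; 2].
Proof.
rewrite /one_line !enum_ordSl enum_ord0 /= !permE /=.
by rewrite -!val_eqE /= !inordK.
Qed.

Fact one_line_dec_max k :
  0 < k -> one_line (dec_max k) = rcons (rev (iota 1 k.-1)) k.
Proof.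
case: k => // k _; rewrite /one_line; apply: (@eq_from_nth _ 0).
  by rewrite size_map size_enum_ord size_rcons size_rev size_iota.
move=> i; rewrite size_map size_enum_ord => lt_ik.
rewrite (nth_map (Ordinal lt_ik)) ?size_enum_ord // permE /= nth_enum_ord //.
rewrite nth_rcons size_rev size_iota /= ltnS.
case: (ltngtP i k) => [lt_i | gt_i | ->] //; last by lia.
by rewrite nth_rev ?size_iota // nth_iota; lia.
Qed.

(* Main.v *)
Require Import Defs.
From mathcomp Require Import all_boot all_fingroup.
From mathcomp Require Import zify.

Set Implicit Arguments.
Unset Strict Implicit.
Unset Printing Implicit Defensive.

(** Both sides are encoded by the set of last cells of blocks. A permutation
    avoiding 123 and 132 is a concatenation of blocks, each filling an interval
    of positions [a, b) with the values n-2-a, n-3-a, ..., n-b, n-1-a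
    (0-based), and it avoids (k-1)...1 k exactly when every block has fewer
    than k cells, i.e. when every k-1 consecutive cells (truncated at the right
    border) contain the last cell of a block. Cutting the rectangle after each
    of these cells gives the tiling. *)

(** * Pattern containment and the three patterns *)

Lemma contains_witness n m (s : 'S_n) (t : 'S_m) (f : 'I_m -> 'I_n) :
    (forall a b : 'I_m, a < b -> f a < f b) ->
    (forall a b, (s (f a) < s (f b)) = (t a < t b)) ->
  contains s t.
Proof.
move=> f_mono f_patt; apply/existsP; exists (finfun f); apply/andP; split.
  by do 2!apply/forallP=> ?; rewrite !ffunE; apply/implyP; apply: f_mono.
by do 2!apply/forallP=> ?; rewrite !ffunE f_patt.
Qed.

Lemma containsP n m (s : 'S_n) (t : 'S_m) :
  reflect (exists2 f : 'I_m -> 'I_n, forall a b : 'I_m, a < b -> f a < f b &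
             forall a b, (s (f a) < s (f b)) = (t a < t b))
          (contains s t).
Proof.
apply: (iffP existsP) => [[f /andP[f_mono f_patt]]|[f f_mono f_patt]].
  exists f => a b; last by have /forallP/(_ b)/eqP := forallP f_patt a.
  by have /forallP/(_ b)/implyP := forallP f_mono a.
exact/existsP/(contains_witness f_mono f_patt).
Qed.

Lemma val_p132 (i : 'I_3) : p132 i = nth 0 [:: 0; 2; 1] i :> nat.
Proof.
rewrite permE /= -!val_eqE /= !inordK //.
by case: i => [[|[|[|]]]] //= _; rewrite inordK.
Qed.

Lemma contains3_witness n (s : 'S_n) (t : 'S_3) (a b c : 'I_n) :
    a < b -> b < c ->
    (forall i j : 'I_3, (s (nth a [:: a; b; c] i) < s (nth a [:: a; b; c] j))
       = (t i < t j)) ->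
  contains s t.
Proof.
move=> lt_ab lt_bc; apply: contains_witness.
by case=> [[|[|[|]]]] //= _ [[|[|[|]]]] //= _ _; lia.
Qed.

Lemma contains_p123P n (s : 'S_n) :
  reflect (exists a b c : 'I_n, [/\ a < b, b < c, s a < s b & s b < s c])
          (contains s p123).
Proof.
apply: (iffP idP) => [/containsP[f f_mono f_patt]|[a [b [c [ab bc sab sbc]]]]].
  exists (f (inord 0)), (f (inord 1)), (f (inord 2)).
  by split; rewrite ?f_patt ?perm1; try apply: f_mono; rewrite !inordK.
apply: (contains3_witness ab bc) => i j; rewrite !perm1.
by case: i j => [[|[|[|]]]] //= _ [[|[|[|]]]] //= _; lia.
Qed.

Lemma contains_p132P n (s : 'S_n) :
  reflect (exists a b c : 'I_n, [/\ a < b, b < c, s a < s c & s c < s b])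
          (contains s p132).
Proof.
apply: (iffP idP) => [/containsP[f f_mono f_patt]|[a [b [c [ab bc sac scb]]]]].
  exists (f (inord 0)), (f (inord 1)), (f (inord 2)).
  by split; rewrite ?f_patt ?val_p132; try apply: f_mono; rewrite !inordK.
apply: (contains3_witness ab bc) => i j; rewrite !val_p132.
by case: i j => [[|[|[|]]]] //= _ [[|[|[|]]]] //= _; lia.
Qed.

Lemma dec_maxE k (i : 'I_k) :
  dec_max k i = (if i.+1 < k then k - 2 - i else i) :> nat.
Proof. by rewrite permE. Qed.

(** Since [e] ranges over ['I_n], windows are truncated at the right border, so the last cell of the
    rectangle is forced into [E]. *)
Definition spaced n d (E : {set 'I_n}) : bool :=
  [forall a : 'I_n, exists e : 'I_n, (e \in E) && (a <= e < a + d)].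

Lemma spacedP n d (E : {set 'I_n}) :
  reflect (forall a : 'I_n, exists2 e : 'I_n, e \in E & a <= e < a + d)
          (spaced d E).
Proof.
apply: (iffP forallP) => E_sp a.
  by have /existsP[e /andP[]] := E_sp a; exists e.
by have [e Ee ae] := E_sp a; apply/existsP; exists e; rewrite Ee.
Qed.

(** * Block starts *)

(* The first cell of the block of [x], when [E] is the set of last cells. *)
Definition block_start n (E : {set 'I_n}) (x : nat) : nat :=
  \max_(e in E | e < x) e.+1.

Section BlockStart.

Variables (n : nat) (E : {set 'I_n}).

Lemma block_start_le x : block_start E x <= x.
Proof. by apply/bigmax_leqP => e /andP[]. Qed.

Lemma lt_block_start (e : 'I_n) x : e \in E -> e < x -> e < block_start E x.
Proof.
move=> Ee ex; rewrite /block_start.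
by rewrite (bigD1 e) ?Ee // /= leq_max leqnn.
Qed.

(** A nonempty maximum is attained; the value 0 is the empty maximum, that is, the block at the left
    border. *)
Lemma block_start_gt0 x :
  0 < block_start E x -> exists2 e : 'I_n, e \in E & block_start E x = e.+1.
Proof.
rewrite /block_start; elim/big_rec: _ => // i m /andP[Ei _] IHm max_gt0.
by rewrite /maxn; case: ltnP => [im|_]; [apply: IHm; lia | exists i].
Qed.

Lemma block_start_eq a x :
    a <= x -> (forall e : 'I_n, e \in E -> e < x -> e < a) ->
    (0 < a -> exists2 e : 'I_n, e \in E & a = e.+1) ->
  block_start E x = a.
Proof.
move=> ax Ea a_gt0; apply/eqP; rewrite eqn_leq; apply/andP; split.
  by apply/bigmax_leqP => e /andP[]; apply: Ea.
case: a ax {Ea} a_gt0 => // a ax /(_ isT)[e Ee ae].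
by rewrite ae lt_block_start -?ae.
Qed.

Lemma block_start_id a x : block_start E x <= a -> a <= x ->
  block_start E a = block_start E x.
Proof.
move=> xa ax; apply: block_start_eq => // [e Ee ea|]; last exact: block_start_gt0.
exact: lt_block_start Ee (leq_trans ea ax).
Qed.

End BlockStart.

(** * Permutations *)

(** In a block starting at [a], the last cell [i] carries n-1-a >= n-1-i, whereas any other cell [i]
    carries n-2-i; the threshold n-1-i separates the two cases. *)
Definition perm_ends n (s : 'S_n) : {set 'I_n} := [set i : 'I_n | n <= s i + i.+1].

Lemma card_ord_ltn n m : m <= n -> #|[set i : 'I_n | i < m]| = m.
Proof.
move=> le_mn; rewrite -sum1dep_card.
by rewrite -(big_ord_widen n (fun=> 1) le_mn) sum1_card card_ord.
Qed.

Lemma card_perm_gt n (s : 'S_n) (i : 'I_n) :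
  #|[set j | s i < s j]| = n - (s i).+1.
Proof.
have -> : [set j | s i < s j] = s @^-1: ~: [set v : 'I_n | v < (s i).+1].
  by apply/setP => j; rewrite !inE -leqNgt.
rewrite card_preimset; last exact: perm_inj.
by rewrite cardsCs setCK card_ord card_ord_ltn.
Qed.

(** More than [i] entries exceed [s i], and only [i] positions precede [i]. *)
Lemma perm_endsN_ascent n (s : 'S_n) (i : 'I_n) :
  i \notin perm_ends s -> exists2 j : 'I_n, i < j & s i < s j.
Proof.
rewrite inE -ltnNge => i_lt.
have /subsetPn[j] : ~~ ([set j | s i < s j] \subset [set j : 'I_n | j < i]).
  apply/negP => /subset_leq_card.
  by rewrite card_perm_gt card_ord_ltn; have := ltn_ord i; lia.
rewrite !inE -leqNgt => sij ij; exists j => //.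
by have : i != j :> nat; [apply: contraTneq sij => /val_inj->; rewrite ltnn | lia].
Qed.

Section Avoiders.

Variables (n : nat) (s : 'S_n).
Hypothesis s123 : ~~ contains s p123.

Lemma avoid_gt_before (a i j : 'I_n) : a < i -> i < j -> s i < s j -> s i < s a.
Proof.
move=> ai ij sij; rewrite ltnNge; apply: contra s123 => sai.
apply/contains_p123P; exists a, i, j; split => //.
have : s a != s i by apply/eqP => /perm_inj eq_ai; rewrite eq_ai ltnn in ai.
by rewrite -val_eqE /=; lia.
Qed.

(** A later larger entry would force all [i] earlier entries above [s i] as well, giving [i.+1]
    larger entries; an end has at most [i]. *)
Lemma perm_ends_max (i j : 'I_n) : i \in perm_ends s -> i < j -> s j < s i.
Proof.
rewrite inE => i_end ij; rewrite ltnNge; apply/negP => sij.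
have {}sij : s i < s j.
  have : s i != s j by apply/eqP => /perm_inj eq_ij; rewrite eq_ij ltnn in ij.
  by rewrite -val_eqE /=; lia.
have /subset_leq_card : j |: [set a : 'I_n | a < i] \subset [set j | s i < s j].
  apply/subsetP => a; rewrite !inE => /predU1P[-> //|ai].
  exact: avoid_gt_before ai ij sij.
by rewrite card_perm_gt cardsU1 inE card_ord_ltn; have := ltn_ord i; lia.
Qed.

Hypothesis s132 : ~~ contains s p132.

(** Two distinct later entries above [s i] form with it a 123 or a 132, according to their order. *)
Lemma avoid_gt_after (i j j' : 'I_n) :
  i < j -> i < j' -> s i < s j -> s i < s j' -> j = j'.
Proof.
wlog: j j' / j < j'.
  move=> wl ij ij' sij sij'; case: (ltngtP j j') => [||/val_inj//] jj'.
    exact: wl.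
  by apply/esym; apply: wl.
move=> jj' ij _ sij sij'; case: (ltngtP (s j) (s j')) => sjj'.
- by case/negP: s123; apply/contains_p123P; exists i, j, j'.
- by case/negP: s132; apply/contains_p132P; exists i, j, j'.
- exact/(@perm_inj _ s)/val_inj.
Qed.

(* Exactly the [i] earlier entries and one later entry exceed [s i]. *)
Lemma perm_endsN_val (i : 'I_n) : i \notin perm_ends s -> s i + i.+2 = n.
Proof.
move=> /perm_endsN_ascent[j ij sij].
have : #|[set j | s i < s j]| = i.+1.
  have -> : [set j | s i < s j] = j |: [set a : 'I_n | a < i].
    apply/setP => a; rewrite !inE; case: (ltngtP a i) => [ai|ia|/val_inj->].
    - by rewrite orbT (avoid_gt_before ai ij sij).
    - rewrite orbF; apply/idP/eqP => [sia|-> //].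
      exact: avoid_gt_after ia ij sia sij.
    - rewrite ltnn orbF; apply/esym/negbTE.
      by apply: contraTneq ij => ->; rewrite ltnn.
  by rewrite cardsU1 inE card_ord_ltn; have := ltn_ord i; lia.
by rewrite card_perm_gt; have := ltn_ord (s i); lia.
Qed.

(** On a window of k-1 cells without an end, the values n-2-e decrease; followed by the later entry
    larger than [s a], they form a copy of [dec_max k]. *)
Lemma spaced_perm_ends k : 1 < k -> ~~ contains s (dec_max k) ->
  spaced (k - 1) (perm_ends s).
Proof.
move=> k_gt1 s_dec; apply/spacedP => a; apply/exists_inP.
apply: contraNT s_dec => /exists_inPn no_end.
have {}no_end (e : 'I_n) : a <= e -> e < a + (k - 1) -> s e + e.+2 = n.
  move=> ae ek; apply: perm_endsN_val.
  by apply/negP => /no_end /negP[]; rewrite ae.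
have sa : s a + a.+2 = n by apply: no_end; lia.
have [j aj saj] : exists2 j : 'I_n, a < j & s a < s j.
  by apply: perm_endsN_ascent; rewrite inE; lia.
(* Inside the window [s j] would be n-2-j, below [s a]. So [j] lies past the window, which therefore
   is not truncated. *)
have kj : a + (k - 1) <= j.
  by rewrite leqNgt; apply/negP => /(no_end _ (ltnW aj)); lia.
have lt_n (x : 'I_k) : (if x.+1 < k then a + x else j) < n.
  by have := ltn_ord j; case: ifP; lia.
apply: (@contains_witness _ _ _ _ (fun x => Ordinal (lt_n x))) => x y.
  move=> /= xy; have := ltn_ord y; do 2!case: ifP; lia.
have f_val (z : 'I_k) : s (Ordinal (lt_n z)) =
    (if z.+1 < k then n - 2 - (a + z) else s j) :> nat.
  have : Ordinal (lt_n z) = (if z.+1 < k then a + z else j) :> nat by [].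
  move: (Ordinal (lt_n z)) => w.
  case: ifP => zk w_val; last by rewrite (val_inj w_val).
  by have := no_end w; lia.
rewrite !f_val !dec_maxE.
have := ltn_ord x; have := ltn_ord y; have := ltn_ord j.
by do 2!case: ifP; lia.
Qed.

End Avoiders.

Lemma perm_ends_inj n (s t : 'S_n) :
    ~~ contains s p123 -> ~~ contains s p132 ->
    ~~ contains t p123 -> ~~ contains t p132 ->
  perm_ends s = perm_ends t -> s = t.
Proof.
move=> s123 s132 t123 t132 eq_st; apply/permP => i.
have [m] := ubnP (i : nat); elim: m i => // m IHm i /ltnSE im.
have [Ei|Ei] := boolP (i \in perm_ends s); last first.
  apply: val_inj => /=; have := perm_endsN_val s123 s132 Ei.
  by rewrite eq_st in Ei; have := perm_endsN_val t123 t132 Ei; lia.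
(* Otherwise the larger of the two values at [i] occurs later in the other
   permutation, because both agree before [i]. *)
have not_lt (u v : 'S_n) : ~~ contains u p123 -> i \in perm_ends u ->
    (forall j : 'I_n, j < i -> u j = v j) -> u i < v i -> False.
  move=> u123 Eu eq_uv uv; set j := (u^-1)%g (v i).
  have uj : u j = v i by rewrite permKV.
  case: (ltngtP j i) => [ji|ij|/val_inj ji].
  - have /perm_inj ji' : v j = v i by rewrite -eq_uv.
    by rewrite ji' ltnn in ji.
  - by have := perm_ends_max u123 Eu ij; rewrite uj; lia.
  - by move: uv; rewrite -uj ji ltnn.
case: (ltngtP (s i) (t i)) => [st|ts|/val_inj//].
- by case: (not_lt s t) => // j ji; apply: IHm; lia.
- case: (not_lt t s) => // [|j ji]; first by rewrite -eq_st.
  by apply/esym/IHm; lia.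
Qed.

Lemma spaced_perm_exists n d (E : {set 'I_n}) : 0 < d -> spaced d E ->
  exists s : 'S_n, [/\ ~~ contains s p123, ~~ contains s p132,
    ~~ contains s (dec_max d.+1) & perm_ends s = E].
Proof.
move=> d_gt0 /spacedP E_sp.
(* This keeps the subtraction [n - i.+2] below from being truncated. *)
have nE (i : 'I_n) : i \notin E -> i.+1 < n.
  move=> Ei; have [e Ee /andP[ie _]] := E_sp i.
  have : i != e :> nat by apply: contraNneq Ei => /val_inj->.
  by have := ltn_ord e; lia.
have lt_n (i : 'I_n) :
    (if i \in E then n - (block_start E i).+1 else n - i.+2) < n.
  by have := ltn_ord i; case: ifP; lia.
pose g i := Ordinal (lt_n i).
have g_inj : injective g.
  have neq (i j : 'I_n) : i < j -> g i <> g j.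
    move=> ij /(congr1 val) /=.
    have := block_start_le E i; have := block_start_le E j.
    have := ltn_ord i; have := ltn_ord j.
    have [Ei|Ei] := boolP (i \in E); have [Ej|Ej] := boolP (j \in E).
    - by have := lt_block_start Ei ij; lia.
    - by have := nE _ Ej; lia.
    (* Equal values would make [i] the cell just before the block of [j], which is an end. *)
    - move=> *; have [|e Ee start_e] := @block_start_gt0 _ E j; first lia.
      have eq_ie : i = e by apply: val_inj => /=; lia.
      by rewrite eq_ie Ee in Ei.
    - by have := nE _ Ej; lia.
  move=> i j gij; case: (ltngtP i j) => [/neq//|ji|/val_inj//].
  by case: (neq j i ji).
pose s : 'S_n := perm g_inj.
have sE i : s i = (if i \in E then n - (block_start E i).+1 else n - i.+2) :> nat.
  by rewrite permE.
(* An ascent stays within one block and finishes at its last cell. In a 123 or a 132, the middle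
   entry is thus an end, which cuts it off from the third entry, although that one also tops an
   ascent starting at or before the middle. *)
have ascent (a b : 'I_n) : a < b -> s a < s b ->
    b \in E /\ block_start E b <= a.
  rewrite !sE => ab.
  have := block_start_le E a; have := block_start_le E b.
  have := ltn_ord a; have := ltn_ord b.
  by do 2!case: ifP; lia.
exists s; split.
- apply/negP => /contains_p123P[a [b [c [ab bc sab sbc]]]].
  have [Eb _] := ascent _ _ ab sab; have [_] := ascent _ _ bc sbc.
  by have := lt_block_start Eb bc; lia.
- apply/negP => /contains_p132P[a [b [c [ab bc sac scb]]]].
  have [||Eb _] := ascent a b; [lia | lia |].
  have [||_] := ascent a c; [lia | lia |].
  by have := lt_block_start Eb bc; lia.
(* The first and last entries of a copy form an ascent between cells at distance at least [d]; the
   end that [spaced] provides among the [d] cells from the first one separates them. *)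
- apply/negP => /containsP[f f_mono f_patt].
  have f_far m (x : 'I_d.+1) : x = m :> nat -> f ord0 + m <= f x.
    elim: m x => [|m IHm] x xm; first by rewrite addn0 (_ : x = ord0) //; apply: val_inj.
    have lt_md : m < d.+1 by have := ltn_ord x; lia.
    have := IHm (Ordinal lt_md) erefl; have := f_mono (Ordinal lt_md) x.
    by rewrite /= xm => /(_ (leqnn _)); lia.
  have f_d := f_far d ord_max erefl.
  have [||_ start_le] := ascent (f ord0) (f ord_max).
  + lia.
  + by rewrite f_patt !dec_maxE /=; case: ifP; case: ifP; lia.
  have [e Ee /andP[fe ed]] := E_sp (f ord0).
  by have := @lt_block_start _ _ e (f ord_max) Ee; lia.
- apply/setP => i; rewrite inE sE.
  have := block_start_le E i; have := ltn_ord i.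
  by case: ifPn => [Ei|/nE]; lia.
Qed.

(** * Tilings *)

Definition tiling_of_ends n (E : {set 'I_n}) : {set {set 'I_n}} :=
  preim_partition (fun x : 'I_n => block_start E x) [set: 'I_n].

Definition tiling_ends n (T : {set {set 'I_n}}) : {set 'I_n} :=
  [set x : 'I_n | [forall y in pblock T x, y <= x]].

Lemma mem_pblock_tiling_of_ends n (E : {set 'I_n}) (x y : 'I_n) :
  (y \in pblock (tiling_of_ends E) x) = (block_start E x == block_start E y).
Proof.
by apply: pblock_equivalence_partition; rewrite ?inE //; split=> // /eqP->.
Qed.

(** The first element of [E] at or after [x] has the same block start as [x], so it is [x] itself
    when [x] is the largest cell of its tile. *)
Lemma tiling_of_endsK n d (E : {set 'I_n}) : spaced d E ->
  tiling_ends (tiling_of_ends E) = E.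
Proof.
move=> /spacedP E_sp; apply/setP => x; rewrite inE.
apply/forall_inP/idP => [x_max|Ex y].
  have [e0 Ee0 /andP[xe0 _]] := E_sp x.
  pose P (e : 'I_n) := (e \in E) && (x <= e).
  have : P e0 by rewrite /P Ee0.
  case/(arg_minnP (fun e : 'I_n => e : nat)) => e /andP[Ee xe] e_min.
  suff /x_max ex : e \in pblock (tiling_of_ends E) x.
    by have <- : e = x by apply: val_inj; apply/eqP; rewrite eqn_leq ex.
  rewrite mem_pblock_tiling_of_ends; apply/eqP/block_start_id => //.
  rewrite leqNgt; apply/negP => x_lt.
  have [|e' Ee' start_e'] := @block_start_gt0 _ E e; first lia.
  by have := block_start_le E e; have := e_min e'; rewrite /P Ee' /=; lia.
rewrite mem_pblock_tiling_of_ends => /eqP start_eq; rewrite leqNgt.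
apply/negP => xy; have := lt_block_start Ex xy.
by rewrite -start_eq; have := block_start_le E x; lia.
Qed.

(** The tile of [x] runs from its block start to the first end from there on, which [spaced] places
    fewer than [d] cells further. *)
Lemma tiling_of_ends_tilings n d (E : {set 'I_n}) : spaced d E ->
  tiling_of_ends E \in tilings n d.
Proof.
move=> /spacedP E_sp; rewrite inE preim_partitionP /=.
apply/forall_inP => B /imsetP[x _ ->].
have start_n : block_start E x < n.
  exact: leq_ltn_trans (block_start_le E x) (ltn_ord x).
have [e0 Ee0 /andP[/= xe0 e0d]] := E_sp (Ordinal start_n).
pose P (e : 'I_n) := (e \in E) && (block_start E x <= e).
have : P e0 by rewrite /P Ee0.
case/(arg_minnP (fun e : 'I_n => e : nat)) => e /andP[Ee xe] e_min.
have ee0 : e <= e0 by apply: e_min; rewrite /P Ee0.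
have lt_d : e - block_start E x < d by lia.
apply/existsP; exists (Ordinal lt_d); apply/existsP; exists (Ordinal start_n) => /=.
apply/andP; split; first by have := ltn_ord e; lia.
apply/eqP/setP => y; rewrite !inE /=; apply/eqP/idP => [start_y|/andP[xy ye]].
  have := block_start_le E y; have := @lt_block_start _ E e y Ee; lia.
apply/esym/block_start_eq => // [e' Ee' e'y|]; last exact: block_start_gt0.
by rewrite ltnNge; apply/negP => xe'; have := e_min e'; rewrite /P Ee' xe'; lia.
Qed.

Section TilingEnds.

Variables (n d : nat) (T : {set {set 'I_n}}).
Hypothesis T_tiling : T \in tilings n d.

Lemma tiling_partition : partition T [set: 'I_n].
Proof. by move: T_tiling; rewrite inE => /andP[]. Qed.

Lemma tiling_trivIset : trivIset T.
Proof. by case/and3P: tiling_partition. Qed.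

Lemma mem_cover_tiling x : x \in cover T.
Proof. by rewrite (cover_partition tiling_partition) inE. Qed.

Lemma tiling_pblock (x : 'I_n) :
  exists i l : nat, [/\ i <= x < i + l, l <= d, i + l <= n &
    forall y : 'I_n, (y \in pblock T x) = (i <= y < i + l)].
Proof.
have xT := mem_cover_tiling x; move: T_tiling; rewrite inE => /andP[_ /forall_inP].
move=> /(_ _ (pblock_mem xT)) /existsP[l /existsP[i /andP[il /eqP defB]]].
have mem_B y : (y \in pblock T x) = (i <= y < i + l.+1) by rewrite defB inE.
by exists i, l.+1; split=> //; rewrite -mem_B mem_pblock.
Qed.

Lemma spaced_tiling_ends : spaced d (tiling_ends T).
Proof.
apply/spacedP => a; have [i [l [ai ld iln mem_a]]] := tiling_pblock a.
have e_n : (i + l).-1 < n by lia.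
exists (Ordinal e_n) => /=; last lia.
rewrite inE; apply/forall_inP => y.
have ea : Ordinal e_n \in pblock T a by rewrite mem_a /=; lia.
by rewrite (same_pblock tiling_trivIset ea) mem_a /=; lia.
Qed.

(** Identifies the block start computed from the ends with the first cell of the tile of [x], the
    link needed to recover [T]. *)
Lemma block_start_tiling_ends (x : 'I_n) :
  exists i : 'I_n, [/\ i = block_start (tiling_ends T) x :> nat, i \in pblock T x &
    forall y : 'I_n, y \in pblock T x -> i <= y].
Proof.
have [i [l [xi ld iln mem_x]]] := tiling_pblock x.
have i_n : i < n by lia.
exists (Ordinal i_n); split=> [|| y] /=; try by rewrite mem_x /=; lia.
apply/esym/block_start_eq => [|e|i_gt0]; first lia.
  rewrite inE => /forall_inP e_max ex; rewrite ltnNge; apply/negP => ie.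
  have e_x : e \in pblock T x by rewrite mem_x; lia.
  have := e_max x; rewrite (same_pblock tiling_trivIset e_x).
  by rewrite mem_pblock mem_cover_tiling => /(_ isT); lia.
(* The cell before [i] is an end: otherwise its tile, being an interval, would contain [i] and so be
   the tile of [x], which begins at [i]. *)
have p_n : i.-1 < n by lia.
exists (Ordinal p_n) => /=; last lia.
rewrite inE; apply/forall_inP => y /= y_p; rewrite leqNgt; apply/negP => py.
have [j [m [pj md jmn mem_p]]] := tiling_pblock (Ordinal p_n).
move: y_p; rewrite mem_p => y_p; rewrite /= in pj.
have i_p : Ordinal i_n \in pblock T (Ordinal p_n) by rewrite mem_p /=; lia.
have i_x : Ordinal i_n \in pblock T x by rewrite mem_x /=; lia.
have := mem_pblock T (Ordinal p_n); rewrite mem_cover_tiling.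
rewrite -(same_pblock tiling_trivIset i_p) (same_pblock tiling_trivIset i_x).
by rewrite mem_x /=; lia.
Qed.

(** A tile is recognised by its first cell, so having the same block start amounts to sharing a
    tile. *)
Lemma tiling_endsK : tiling_of_ends (tiling_ends T) = T.
Proof.
have eq_start (x y : 'I_n) :
    (block_start (tiling_ends T) x == block_start (tiling_ends T) y)
    = (pblock T x == pblock T y).
  have [i [def_i ix i_min]] := block_start_tiling_ends x.
  have [j [def_j jy j_min]] := block_start_tiling_ends y.
  rewrite -def_i -def_j; apply/eqP/eqP => [/val_inj eq_ij|eq_xy].
    by rewrite -(same_pblock tiling_trivIset ix) eq_ij (same_pblock tiling_trivIset jy).
  by apply/eqP; rewrite eqn_leq i_min ?j_min // -?eq_xy // eq_xy.
rewrite -[RHS](preim_partition_pblock tiling_partition).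
apply: eq_in_imset => x _; apply/setP => y; rewrite !inE /=; exact: eq_start.
Qed.

End TilingEnds.

(** * Assembling the bijection *)

Lemma bijective_sig_set (aT rT : finType) (A : {set aT}) (B : {set rT}) (f : aT -> rT) :
    {in A, forall x, f x \in B} -> {in A &, injective f} ->
    {in B, forall y, exists2 x, x \in A & f x = y} ->
  exists g : {x | x \in A} -> {y | y \in B}, bijective g.
Proof.
move=> fAB f_inj f_surj.
exists (fun x => exist _ (f (sval x)) (fAB _ (svalP x))).
(* Both types are finite: surjectivity enters only through the cardinality bound, and no inverse is
   built. *)
apply: inj_card_bij => [x y [/f_inj eq_xy]|].
  exact: val_inj (eq_xy (svalP x) (svalP y)).
rewrite !card_sig -(card_in_imset f_inj); apply/subset_leq_card/subsetP => y.
by move=> /f_surj[x Ax <-]; apply: imset_f.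
Qed.

Theorem theorem3p13 (n k : nat) (hn : 1 <= n) (hk : 2 <= k) :
  exists f : {s : 'S_n | s \in avoiders n [:: Pattern p123; Pattern p132; Pattern (dec_max k)]} ->
             {T : {set {set 'I_n}} | T \in tilings n (k - 1)},
    bijective f.
Proof.
have sp (s : 'S_n) :
    s \in avoiders n [:: Pattern p123; Pattern p132; Pattern (dec_max k)] ->
    [/\ ~~ contains s p123, ~~ contains s p132 & spaced (k - 1) (perm_ends s)].
  rewrite inE /= andbT => /and3P[s123 s132 sdec]; split=> //.
  exact: spaced_perm_ends.
apply: (@bijective_sig_set _ _ _ _ (fun s => tiling_of_ends (perm_ends s))).
- by move=> s /sp[_ _]; apply: tiling_of_ends_tilings.
- move=> s t /sp[s123 s132 s_sp] /sp[t123 t132 t_sp] /(congr1 (@tiling_ends n)).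
  by rewrite (tiling_of_endsK s_sp) (tiling_of_endsK t_sp); apply: perm_ends_inj.
move=> T T_tiling.
have [|s [s123 s132 sdec s_ends]] := spaced_perm_exists _ (spaced_tiling_ends T_tiling).
  by lia.
have dk : (k - 1).+1 = k by lia.
rewrite dk in sdec; exists s; first by rewrite inE /= s123 s132 sdec.
by rewrite s_ends (tiling_endsK T_tiling).
Qed.
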